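(* Let $\vec\psi'=A(x)\vec\psi$ be a Fuchsian $n\times n$ linear system with fundamental matrix of solutions $W(x)$ and with monodromy matrix $M_0$ around the singularity $0$. For a generic perturbation matrix $B$, the monodromy matrix $M_{0,\rho}$ around $0$ of the deformed system $\vec\psi'=A\vec\psi+\rho B\vec\psi$ is given by $$M_{0,\rho}=M_0+\left(M_0\,C(xe^{2\pi i})\,M_0^{-1}-C(x)\right)M_0\,\rho+\mathcal{O}(\rho^2),$$ where $$C(x)=\int_0^x W^{-1}(t)B(t)W(t)\,dt .$$
   Context: A fundamental matrix is a matrix whose columns form a basis of solutions of the system; the system $\vec\psi'=A\vec\psi$ is assumed to have $n$ linearly independent solutions, so that $W$ is generically invertible. For a multivalued function $F$, $F(x)$ denotes a fixed branch and $F(xe^{2\pi i})$ denotes the branch obtained by looping around $0$ once. The monodromy matrix $M_0$ is defined by $W(xe^{2\pi i})=W(x)M_0$. The deformed system has fundamental matrix $W_\rho=W(I+\rho C+\mathcal{O}(\rho^2))$, given by its Dyson-type series, and $M_{0,\rho}$ is defined by $W_\rho(xe^{2\pi i})=W_\rho(x)M_{0,\rho}$; it may depend on $x$. The parameter $\rho$ is formal or a sufficiently small complex number. *)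

(* Defs.v *)
From HB Require Import structures.
From mathcomp Require Import all_boot all_order all_algebra.
From mathcomp Require Import all_classical all_reals all_analysis.
From mathcomp Require Import complex.

Set Implicit Arguments.
Unset Strict Implicit.
Unset Printing Implicit Defensive.

Import Order.TTheory GRing.Theory Num.Theory.
Import numFieldNormedType.Exports.

Local Open Scope classical_set_scope.
Local Open Scope ring_scope.
Local Open Scope complex_scope.

(* A multivalued function F on the punctured disc 0 < |x| < r is a function on
   the universal cover of that disc, written in the coordinate s = log x:
   [F s] is the value at x = cexp s of the branch that s selects, s ranges over
   the half-plane [logdisc r], and the branch F(x e^(2 pi i)) is [F (loop s)]. *)

Definition cexp (R : realType) (s : R[i]) : R[i] :=
  (expR (complex.Re s))%:C * (cos (complex.Im s) +i* sin (complex.Im s)).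

Definition logdisc (R : realType) (r : R) : set R[i] :=
  [set s | `|cexp s| < r%:C].

Definition loop (R : realType) (s : R[i]) : R[i] := s + (0 +i* (pi *+ 2)).

(* d/dx = e^(-s) d/ds, so F has x-derivative d at s when dF/ds = e^s d. *)
Definition is_xderive (R : realType) (F : R[i] -> R[i]) (s d : R[i]) : Prop :=
  is_derive (s : R[i]^o) (1 : R[i]^o) (F : R[i]^o -> R[i]^o) (cexp s * d).

Definition mx_is_xderive (R : realType) (m n : nat) (F : R[i] -> 'M[R[i]]_(m, n))
    (s : R[i]) (D : 'M[R[i]]_(m, n)) : Prop :=
  forall i j, is_xderive (fun u => F u i j) s (D i j).

Definition mx_holomorphic (R : realType) (r : R) (m n : nat)
    (F : R[i] -> 'M[R[i]]_(m, n)) : Prop :=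
  forall s, logdisc r s -> exists D, mx_is_xderive F s D.

(* The coefficient matrix P of a linear system may itself be multivalued. *)
Definition is_solution (R : realType) (r : R) (n : nat)
    (P : R[i] -> 'M[R[i]]_n) (psi : R[i] -> 'cV[R[i]]_n) : Prop :=
  forall s, logdisc r s -> mx_is_xderive psi s (P s *m psi s).

Definition is_fundamental (R : realType) (r : R) (n : nat)
    (P W : R[i] -> 'M[R[i]]_n) : Prop :=
  (forall j, is_solution r P (fun s => col j (W s))) /\
  (forall psi, is_solution r P psi ->
    exists! c : 'cV[R[i]]_n, forall s, logdisc r s -> psi s = W s *m c).

(* With A tending to 0 like 1/x at infinity, infinity is at most a Fuchsian
   singularity as well, with residue minus the sum of the finite ones. *)
Definition is_fuchsian (R : realType) (n : nat) (sing : seq R[i])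
    (A : R[i] -> 'M[R[i]]_n) : Prop :=
  uniq sing /\
  exists2 res : R[i] -> 'M[R[i]]_n,
    (forall a, a \in sing -> res a != 0) &
    (forall x, x \notin sing -> A x = \sum_(a <- sing) (x - a)^-1 *: res a).

Definition is_monodromy (R : realType) (r : R) (n : nat)
    (W M : R[i] -> 'M[R[i]]_n) : Prop :=
  forall s, logdisc r s -> W (loop s) = W s *m M s.

(* The integral of f(t) dt from 0 to x is taken along the ray
   t = tau e^(i theta), 0 < tau <= |x|, on the sheet of x, i.e.
   theta = Im s, log t = ln tau + i theta and dt = e^(i theta) d tau. *)
Definition ray (R : realType) (s : R[i]) (tau : R) : R[i] := ln tau +i* complex.Im s.

Definition ray_integrable (R : realType) (f : R[i] -> R[i]) (s : R[i]) : Prop :=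
  (@lebesgue_measure R).-integrable `]0, expR (complex.Re s)]
     (fun tau => (complex.Re (f (ray s tau)))%:E) /\
  (@lebesgue_measure R).-integrable `]0, expR (complex.Re s)]
     (fun tau => (complex.Im (f (ray s tau)))%:E).

Definition ray_integral (R : realType) (f : R[i] -> R[i]) (s : R[i]) : R[i] :=
  (cos (complex.Im s) +i* sin (complex.Im s)) *
  (Rintegral (@lebesgue_measure R) `]0, expR (complex.Re s)]
     (fun tau => complex.Re (f (ray s tau)))
   +i* Rintegral (@lebesgue_measure R) `]0, expR (complex.Re s)]
     (fun tau => complex.Im (f (ray s tau)))).

Definition mx_ray_integrable (R : realType) (n : nat)
    (F : R[i] -> 'M[R[i]]_n) (s : R[i]) : Prop :=
  forall i j, ray_integrable (fun u => F u i j) s.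

Definition mx_ray_integral (R : realType) (n : nat)
    (F : R[i] -> 'M[R[i]]_n) (s : R[i]) : 'M[R[i]]_n :=
  \matrix_(i, j) ray_integral (fun u => F u i j) s.

Definition conj_by (R : realType) (n : nat) (W B : R[i] -> 'M[R[i]]_n)
    (s : R[i]) : 'M[R[i]]_n := invmx (W s) *m B s *m W s.

Definition Cmx (R : realType) (n : nat) (W B : R[i] -> 'M[R[i]]_n) :
    R[i] -> 'M[R[i]]_n := mx_ray_integral (conj_by W B).

(* The Dyson series of W_rho is the sum over k of rho^k W C_k, where C_0 = I
   and C_(k+1)(x) is the integral from 0 to x of W^-1 B W C_k. *)
Fixpoint dyson_iter (R : realType) (n : nat) (W B : R[i] -> 'M[R[i]]_n)
    (k : nat) : R[i] -> 'M[R[i]]_n :=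
  if k is k'.+1 then
    mx_ray_integral (fun u => conj_by W B u *m dyson_iter W B k' u)
  else fun=> 1%:M.

Definition dyson_term (R : realType) (n : nat) (W B : R[i] -> 'M[R[i]]_n)
    (k : nat) (s : R[i]) : 'M[R[i]]_n := W s *m dyson_iter W B k s.

Definition mx_has_sum (R : realType) (n : nat) (u : nat -> 'M[R[i]]_n)
    (S : 'M[R[i]]_n) : Prop :=
  forall i j, (fun N : nat => \sum_(k < N) (u k i j : R[i]^o)) @ \oo --> (S i j : R[i]^o).

(* Product of formal power series in rho with matrix coefficients. *)
Definition fps_mul (R : realType) (n : nat) (u v : nat -> 'M[R[i]]_n)
    (k : nat) : 'M[R[i]]_n := \sum_(i < k.+1) u i *m v (k - i)%N.

Definition mx_O_rho2 (R : realType) (n : nat) (E : R[i] -> 'M[R[i]]_n) : Prop :=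
  exists K delta : R, 0 < delta /\
    forall rho : R[i], `|rho| < delta%:C ->
      forall i j, `|E rho i j| <= K%:C * `|rho| ^+ 2.

(* Main.v *)
(** The columns of a fundamental matrix W are independent solutions of a system
    whose coefficients are bounded on segments of the half-plane of s = log x,
    so by Gronwall's inequality a combination of columns that vanishes at one
    point vanishes everywhere: W(s) is invertible, and hence so is M0. The formal
    expansion follows by comparing coefficients of rho^0 and rho^1 in
    W_rho(x e^(2 pi i)) = W_rho(x) M_rho. For complex rho, convergence of the
    Dyson series on a disc gives W_rho = W (I + rho C) + O(rho^2) at x and at
    x e^(2 pi i), and invertibility of W(x) lets one divide. *)
Require Import Defs.
From mathcomp Require Import all_boot all_order all_algebra.
From mathcomp Require Import all_classical all_reals all_analysis.
From mathcomp Require Import complex.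
From mathcomp Require Import ring.

Import Order.TTheory GRing.Theory Num.Theory.
Import numFieldNormedType.Exports.

Local Open Scope classical_set_scope.
Local Open Scope ring_scope.
Local Open Scope complex_scope.

(** * Gronwall's inequality and uniqueness for linear systems along a segment *)

(** The product of [h] with the integrating factor [expR (- K * t)] has nonpositive derivative, so
    it decreases from its initial value 0. *)
Lemma gronwall_eq0 (R : realType) (h dh : R -> R) (K : R) :
  (forall t : R, t \in `[0, 1] -> is_derive t 1 h (dh t)) ->
  (forall t : R, t \in `[0, 1] -> dh t <= K * h t) ->
  h 0 = 0 -> 0 <= h 1 -> h 1 = 0.
Proof.
move=> hdh dhK h0 h1; apply/eqP; rewrite eq_le h1 andbT.
pose g : R -> R := h * (fun t => expR (- K * t)).
pose dg t := h t * (- K * expR (- K * t)) + expR (- K * t) * dh t.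
have gd (t : R) : t \in `[0, 1] -> is_derive t 1 g (dg t).
  move=> t01; apply: is_deriveM; first exact: hdh.
  have lin : is_derive t 1 (fun u : R => - K * u) (- K).
    by have := is_deriveZ (- K) (is_derive_id t (1 : R)); rewrite [_ *: 1]mulr1.
  rewrite [- K * _]mulrC; exact: (@is_derive1_comp _ expR).
have inc (t : R) : t \in `]0, 1[ -> t \in `[0, 1].
  by rewrite !in_itv/= => /andP[/ltW-> /ltW->].
have : g 1 <= g 0.
  apply: (@ler0_derive1_le_cc _ g 0 1); rewrite ?bound_itvE ?ler01//.
  - by move=> t /inc/gd[].
  - move=> t /inc t01; rewrite derive1E; case: (gd _ t01) => _ ->.
    have -> : dg t = expR (- K * t) * (dh t - K * h t) by rewrite /dg; ring.
    by rewrite pmulr_rle0 ?expR_gt0// subr_le0 dhK.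
  - by apply: derivable_within_continuous => t /gd[].
by rewrite /g /= /GRing.mul/= h0 mul0r pmulr_lle0 ?expR_gt0.
Qed.

(** This is a chain rule for the real and imaginary parts of [F] along the line through [s] with
    direction [v]. The three hypotheses on [phi] are the properties shared by [Re] and [Im]: real
    linearity and norm at most 1. *)
Lemma is_derive_along (R : realType) (phi : R[i] -> R) (F : R[i] -> R[i])
    (s v d : R[i]) (t : R) :
  (forall x y, phi (x - y) = phi x - phi y) ->
  (forall (u : R) x, phi (u%:C * x) = u * phi x) ->
  (forall x, `|phi x|%:C <= `|x|) ->
  is_derive (s + t%:C * v : R[i]^o) (1 : R[i]^o) (F : R[i]^o -> R[i]^o) d ->
  is_derive (t : R) (1 : R) (fun u : R => phi (F (s + u%:C * v)) : R) (phi (v * d)).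
Proof.
move=> phiB phiZ phile [/cvg_ex[l cl] Dd]; move: Dd; rewrite /derive (cvg_lim _ cl)// => ld.
move: cl; rewrite {}ld => /cvgrPdist_lt cl.
suff cphi : u^-1 *: (phi (F (s + (u *: 1 + t)%:C * v)) - phi (F (s + t%:C * v)))
    @[u --> 0^'] --> phi (v * d).
  by apply: DeriveDef; [exact: cvgP cphi | exact: cvg_lim cphi].
apply/cvgrPdist_le => e e0.
have gt0E (x : R[i]) : 0 < x -> (complex.Re x)%:C = x.
  by move=> x0; rewrite RRe_real// gtr0_real.
have v1 : 0 < `|v| + 1 by rewrite ltr_wpDl.
(* The error of the complex quotient is later multiplied by [v], which this tolerance absorbs; the
   summand 1 keeps the denominator nonzero. *)
have /cl : 0 < e%:C / (`|v| + 1) by rewrite divr_gt0// ltcR.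
rewrite near_withinE => Hn.
have [del /= del0 Hdel] := (@nbhs_norm0P _ _ _).1 Hn.
rewrite near_withinE; apply: (@nbhs_norm0P R R^o _).2.
exists (complex.Re (del / (`|v| + 1))) => /=.
  by rewrite -ltcR gt0E divr_gt0.
move=> u /= ud u0; rewrite -lecR.
(* For [v = 0] the increment [u%:C * v] never enters the punctured neighbourhood, but then the path
   is constant. *)
have [->|v0] := eqVneq v 0.
  rewrite mul0r !mulr0 subrr scaler0 subr0.
  have -> : phi 0 = 0 by rewrite -[X in phi X](subrr 0) phiB subrr.
  by rewrite normr0 lecR ltW.
have u0C : u%:C != 0 by rewrite (inj_eq (@complexI _)).
have huv : `|u%:C * v| < del.
  move: ud; rewrite -ltcR gt0E ?divr_gt0// ltr_pdivlMr// => ud.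
  rewrite normrM; apply: le_lt_trans ud.
  by rewrite normc_def/= expr0n/= addr0 sqrtr_sqr ler_wpM2l ?lecR// lerDl.
have := Hdel (u%:C * v) _ (mulf_neq0 u0C v0).
move=> /(_ huv); rewrite [u *: 1]mulr1 [(u%:C * v)%:A]mulr1.
have -> : u%:C * v + (s + t%:C * v) = s + (u + t)%:C * v.
  by rewrite rmorphD/= mulrDl addrCA.
rewrite -phiB; set D := F _ - _ => /ltW hD.
have -> : phi (v * d) - u^-1 *: phi D = phi (v * (d - (u%:C * v)^-1 * D)).
  have -> : v * (d - (u%:C * v)^-1 * D) = v * d - (u^-1)%:C * D.
    by rewrite fmorphV/=; field; rewrite v0 u0C.
  by rewrite [RHS]phiB phiZ.
apply: le_trans (phile _) _; rewrite normrM.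
apply: le_trans (ler_wpM2l (normr_ge0 _) hD) _.
rewrite mulrCA ler_piMr ?lecR ?ltW//.
by rewrite ltr_pdivrMr// mul1r ltrDl.
Qed.

Lemma normc_ge_Im (R : realType) (x : R[i]) : `|complex.Im x|%:C <= `|x|.
Proof.
rewrite -normrN -ReiNIm; apply: le_trans (normc_ge_Re _) _.
by rewrite normrM (_ : `|'i| = 1) ?mulr1//; exact: normCi.
Qed.

(** The left side is the real inner product of [a] and [b] as plane vectors. It arises as half the
    derivative of a squared modulus. *)
Lemma Re_Im_cauchy (R : realType) (a b : R[i]) :
  (complex.Re a * complex.Re b + complex.Im a * complex.Im b)%:C <= `|a| * `|b|.
Proof.
have -> : complex.Re a * complex.Re b + complex.Im a * complex.Im b =
    complex.Re (a^*%C * b) by case: a b => [? ?] [? ?] /=; rewrite mulNr opprK.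
rewrite -(normcJ a) -normrM; apply: le_trans (normc_ge_Re _).
by rewrite lecR ler_norm.
Qed.

(** Along the segment, the squared Euclidean norm [h] of [psi] satisfies h' <= 2 n |v| L h, so
    Gronwall's inequality applies. Squaring keeps [h] differentiable at zeros of [psi]. *)
Lemma linear_ode_eq0 (R : realType) (n : nat) (Q : R[i] -> 'M[R[i]]_n)
    (psi : R[i] -> 'cV[R[i]]_n) (s v : R[i]) (L : R) :
  (forall t : R, t \in `[0, 1] -> forall i,
     is_derive (s + t%:C * v : R[i]^o) (1 : R[i]^o)
       ((fun u => psi u i 0) : R[i]^o -> R[i]^o)
       ((Q (s + t%:C * v) *m psi (s + t%:C * v)) i 0)) ->
  (forall t : R, t \in `[0, 1] -> forall i j, `|Q (s + t%:C * v) i j| <= L%:C) ->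
  psi s = 0 -> psi (s + v) = 0.
Proof.
move=> dpsi QL psi0.
pose p (t : R) i := psi (s + t%:C * v) i 0.
pose d (t : R) i := (Q (s + t%:C * v) *m psi (s + t%:C * v)) i 0.
pose f i : R -> R := (fun t => complex.Re (p t i)) ^+ 2 +
                     (fun t => complex.Im (p t i)) ^+ 2.
pose df t i := (2 * complex.Re (p t i) ^+ 1) *: complex.Re (v * d t i) +
               (2 * complex.Im (p t i) ^+ 1) *: complex.Im (v * d t i).
pose h : R -> R := \sum_(i < n) f i.
pose dh t := \sum_(i < n) df t i.
have hE t : h t = \sum_(i < n) (complex.Re (p t i) ^+ 2 + complex.Im (p t i) ^+ 2).
  by rewrite /h fct_sumE.
have hd (t : R) : t \in `[0, 1] -> is_derive t 1 h (dh t).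
  move=> t01.
  suff fd i : is_derive t 1 (f i) (df t i) by exact: (is_derive_sum fd).
  have di := dpsi t t01 i.
  apply: is_deriveD; apply: is_deriveX; apply: is_derive_along di.
  - by move=> [? ?] [? ?].
  - by move=> u [? ?] /=; rewrite mul0r subr0.
  - exact: normc_ge_Re.
  - by move=> [? ?] [? ?].
  - by move=> u [? ?] /=; rewrite mul0r addr0.
  - exact: normc_ge_Im.
have hC t : (h t)%:C = \sum_(i < n) `|p t i| ^+ 2.
  by rewrite hE rmorph_sum/=; apply: eq_bigr => i _; rewrite add_Re2_Im2.
have [c cE] : exists c : R, c%:C = `|v| * L%:C.
  by exists (complex.Re `|v| * L); rewrite rmorphM.
have dhK (t : R) : t \in `[0, 1] -> dh t <= (c * n%:R *+ 2) * h t.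
  move=> t01; rewrite -lecR rmorphM/= hC rmorph_sum/=.
  apply: (@le_trans _ _ (\sum_(i < n) \sum_(k < n)
      c%:C * (`|p t i| ^+ 2 + `|p t k| ^+ 2))).
    apply: ler_sum => i _.
    apply: (@le_trans _ _ (2 * (`|p t i| * (`|v| * `|d t i|)))).
      rewrite -(normrM v).
      apply: le_trans _ (ler_wpM2l (ler0n _ 2) (Re_Im_cauchy _ (p t i) (v * d t i))).
      have -> : 2 = (2 : R)%:C by rewrite rmorph_nat.
      rewrite -rmorphM lecR /df !expr1 /GRing.scale/=.
      by rewrite mulrDr !mulrA.
    have dle : `|v| * `|d t i| <= c%:C * \sum_(k < n) `|p t k|.
      rewrite cE -mulrA ler_wpM2l// /d mxE mulr_sumr.
      apply: le_trans (ler_norm_sum _ _ _) _.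
      by apply: ler_sum => k _; rewrite normrM ler_wpM2r// QL.
    apply: le_trans (ler_wpM2l (ler0n _ 2) (ler_wpM2l (normr_ge0 _) dle)) _.
    rewrite !mulr_sumr; apply: ler_sum => k _.
    (* The sign of [L] is read off from an entry of [Q], so it is available only once indices are
       given. *)
    have c0 : 0 <= c%:C.
      rewrite cE mulr_ge0//; exact: le_trans (normr_ge0 _) (QL t t01 i k).
    (* AM-GM: 2 |p_i| |p_k| <= |p_i|^2 + |p_k|^2. *)
    have sq0 : 0 <= (`|p t i| - `|p t k|) ^+ 2.
      by rewrite real_exprn_even_ge0// rpredB// normr_real.
    rewrite -subr_ge0; apply: le_trans (mulr_ge0 c0 sq0) _.
    by rewrite le_eqVlt; apply/orP; left; apply/eqP; ring.
  (* Each of the two squares contributes n S to the double sum, whence the factor 2 n in the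
     Gronwall constant. *)
  set S := \sum_(i < n) _ ^+ 2.
  rewrite (eq_bigr (fun i => c%:C * (`|p t i| ^+ 2 *+ n + S))) => [|i _]; last first.
    by rewrite -mulr_sumr big_split/= sumr_const card_ord.
  rewrite -mulr_sumr big_split/= sumr_const card_ord sumrMnl.
  rewrite le_eqVlt; apply/orP; left; apply/eqP.
  rewrite rmorphMn rmorphM/= rmorph_nat -/S -mulr2n.
  by rewrite -!(mulr_natr S) -mulr_natr; move: (c%:C) S => x y; ring.
have h0 : h 0 = 0.
  rewrite hE big1// => i _.
  by rewrite /p mul0r addr0 psi0 mxE/= expr0n addr0.
have hge t : 0 <= h t.
  by rewrite hE sumr_ge0// => i _; rewrite addr_ge0// sqr_ge0.
have h1 : h 1 = 0 by apply: gronwall_eq0 hd dhK h0 (hge 1).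
apply/matrixP => i j; rewrite ord1 mxE; apply/eqP; rewrite -normr_eq0 -sqrf_eq0.
have := hC 1; rewrite h1 => /esym/eqP.
rewrite psumr_eq0; last by move=> k _; rewrite exprn_ge0.
by move=> /allP/(_ i (mem_index_enum _)); rewrite /p mul1r.
Qed.

(** * Fuchsian systems in the logarithmic coordinate *)

Lemma norm_cexp (R : realType) (s : R[i]) : `|cexp s| = (expR (complex.Re s))%:C.
Proof.
rewrite /cexp normrM !normc_def/= expr0n/= addr0 sqrtr_sqr cos2Dsin2 sqrtr1 mulr1.
by rewrite ger0_norm// expR_ge0.
Qed.

Lemma logdiscE (R : realType) (r : R) (s : R[i]) :
  logdisc r s <-> expR (complex.Re s) < r.
Proof. by rewrite /logdisc /= norm_cexp ltcR. Qed.

Lemma logdisc_loop (R : realType) (r : R) (s : R[i]) :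
  logdisc r s -> logdisc r (loop s).
Proof. by rewrite !logdiscE /loop raddfD/= addr0. Qed.

(** Since d/ds = x d/dx, the coefficient matrix in the coordinate s is x A(x). The factor x cancels
    the pole at 0, and the other singularities stay at distance at least r - e^m from x. Thus |x /
    (x - a)| is 1 for a = 0 and at most e^m / (r - e^m) otherwise; the sum of the two covers both
    cases. *)
Lemma fuchsian_bound (R : realType) (n : nat) (sing : seq R[i])
    (A : R[i] -> 'M[R[i]]_n) (r m : R) :
  is_fuchsian sing A ->
  (forall a : R[i], a \in sing -> a != 0 -> r%:C <= `|a|) ->
  expR m < r ->
  exists L : R, forall s, complex.Re s <= m ->
    forall i j, `|cexp s * A (cexp s) i j| <= L%:C.
Proof.
move=> [_ [res _ Ares]] hsing mr.
have rm0 : 0 < (r - expR m)%:C by rewrite ltcR subr_gt0.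
pose L := \sum_(a <- sing) \sum_i \sum_j
  (1 + (expR m)%:C / (r - expR m)%:C) * `|res a i j|.
have q0 : 0 <= (expR m)%:C / (r - expR m)%:C.
  by rewrite divr_ge0 ?ltW// ltcR expR_gt0.
have L0 : 0 <= L.
  do 3! (apply: sumr_ge0 => ? _); by rewrite mulr_ge0// addr_ge0.
exists (complex.Re L) => s sm i j.
rewrite RRe_real ?ger0_real//.
have xm : `|cexp s| <= (expR m)%:C by rewrite norm_cexp lecR ler_expR.
have x0 : cexp s != 0 by rewrite -normr_gt0 norm_cexp ltcR expR_gt0.
have xsing : cexp s \notin sing.
  by apply/negP => /hsing/(_ x0)/le_trans/(_ xm); rewrite lecR leNgt mr.
rewrite Ares// summxE mulr_sumr; apply: le_trans (ler_norm_sum _ _ _) _.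
rewrite /L !big_seq; apply: ler_sum => a asing.
apply: (@le_trans _ _ ((1 + (expR m)%:C / (r - expR m)%:C) * `|res a i j|)).
  rewrite mxE mulrA normrM ler_wpM2r//.
  have [->|a0] := eqVneq a 0.
    by rewrite subr0 divff// normr1 lerDl.
  apply: (@le_trans _ _ ((expR m)%:C / (r - expR m)%:C)); last by rewrite lerDr.
  have xa : (r - expR m)%:C <= `|cexp s - a|.
    rewrite distrC; apply: le_trans (lerB_dist _ _).
    by rewrite rmorphB/= lerB// hsing.
  rewrite normrM normfV ler_pM// ?invr_ge0//.
  by rewrite lef_pV2// ?posrE//; exact: lt_le_trans xa.
rewrite (bigD1 i)//= (bigD1 j)//= -addrA lerDl addr_ge0//.
  by apply: sumr_ge0 => ? _; rewrite mulr_ge0// addr_ge0.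
by do 2! (apply: sumr_ge0 => ? _); rewrite mulr_ge0// addr_ge0.
Qed.

(** The half-plane [logdisc r] is convex, and on the segment from [s0] to [s] the real part stays
    below the larger of its end values, where x A(x) is bounded. *)
Lemma solution_eq0 (R : realType) (n : nat) (sing : seq R[i])
    (A : R[i] -> 'M[R[i]]_n) (r : R) (psi : R[i] -> 'cV[R[i]]_n) (s0 s : R[i]) :
  is_fuchsian sing A ->
  (forall a : R[i], a \in sing -> a != 0 -> r%:C <= `|a|) ->
  is_solution r (fun u => A (cexp u)) psi ->
  logdisc r s0 -> logdisc r s -> psi s0 = 0 -> psi s = 0.
Proof.
move=> hA hsing hpsi s0r sr psi0.
pose m := Num.max (complex.Re s0) (complex.Re s).
have mr : expR m < r.
  by rewrite /m; case: (leP (complex.Re s0)) => _; apply/logdiscE.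
have [L hL] := @fuchsian_bound R n sing A r m hA hsing mr.
have Rem (t : R) : t \in `[0, 1] -> complex.Re (s0 + t%:C * (s - s0)) <= m.
  rewrite in_itv/= => /andP[t0 t1].
  have -> : complex.Re (s0 + t%:C * (s - s0)) =
      (1 - t) * complex.Re s0 + t * complex.Re s.
    by case: (s0) (s) => [a b] [c d] /=; ring.
  have -> : m = (1 - t) * m + t * m by ring.
  by rewrite lerD// ler_wpM2l ?subr_ge0// /m le_max lexx ?orbT.
rewrite -(subrK s0 s) addrC.
apply: (@linear_ode_eq0 R n (fun u => cexp u *: A (cexp u)) psi s0 (s - s0) L) => //.
- move=> t t01 i.
  have tr : logdisc r (s0 + t%:C * (s - s0)).
    by apply/logdiscE; apply: le_lt_trans mr; rewrite ler_expR Rem.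
  by apply: (is_derive_eq (hpsi _ tr i 0)); rewrite -scalemxAl [RHS]mxE.
- by move=> t t01 i j; rewrite mxE; apply: hL; apply: Rem.
Qed.

Lemma is_solution_mul (R : realType) (n : nat) (r : R)
    (P W : R[i] -> 'M[R[i]]_n) (c : 'cV[R[i]]_n) :
  (forall j, is_solution r P (fun s => col j (W s))) ->
  is_solution r P (fun s => W s *m c).
Proof.
move=> hW s sr i j; rewrite /is_xderive.
pose f k : R[i]^o -> R[i]^o := fun u => c k j *: (W u i k : R[i]^o).
pose df k : R[i]^o := c k j *: (cexp s * (P s *m W s) i k : R[i]^o).
have fd k : is_derive (s : R[i]^o) (1 : R[i]^o) (f k) (df k).
  apply: is_deriveZ; have := hW k s sr i 0; rewrite /is_xderive.
  have -> : (P s *m col k (W s)) i 0 = (P s *m W s) i k.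
    by rewrite colE mulmxA -colE mxE.
  by under eq_fun do rewrite mxE.
have := is_derive_sum fd.
have -> : \sum_(k < n) f k = (fun u => (W u *m c) i j).
  apply/funext => u; rewrite fct_sumE mxE; apply: eq_bigr => k _.
  by rewrite /f mulrC.
suff -> : \sum_(k < n) df k = cexp s * (P s *m (W s *m c)) i j by [].
rewrite mulmxA [in RHS]mxE mulr_sumr; apply: eq_bigr => k _.
by rewrite [LHS]mulrCA; congr (_ * _); exact: mulrC.
Qed.

(** A kernel vector [v] of [W s] yields the solution [W u *m v], which vanishes at [s] and so
    everywhere. Then [v] and 0 are coordinates of the same solution, and uniqueness gives [v = 0].
    The transpose appears because [kermx] is a left kernel. *)
Lemma fundamental_unitmx (R : realType) (n : nat) (sing : seq R[i])
    (A W : R[i] -> 'M[R[i]]_n) (r : R) (s : R[i]) :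
  is_fuchsian sing A ->
  (forall a : R[i], a \in sing -> a != 0 -> r%:C <= `|a|) ->
  is_fundamental r (fun u => A (cexp u)) W -> logdisc r s -> W s \in unitmx.
Proof.
move=> hA hsing [Wsol Wuniq] sr.
rewrite -unitmx_tr -row_free_unit -kermx_eq0; apply/eqP/row_matrixP => k.
rewrite row0; set v := row k _.
have Wv : W s *m v^T = 0.
  by apply: trmx_inj; rewrite trmx_mul trmxK -row_mul mulmx_ker row0 trmx0.
have vsol := @is_solution_mul _ _ _ _ _ v^T Wsol.
have [c [_ cu]] := Wuniq _ vsol.
rewrite -[v]trmxK; have <- : c = v^T by apply: cu.
suff -> : c = 0 by rewrite trmx0.
apply: cu => u ur; rewrite mulmx0.
exact: (@solution_eq0 _ _ _ _ _ _ _ _ hA hsing vsol sr ur).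
Qed.

(** * An entrywise matrix norm *)

(** This norm is submultiplicative and dominates every entry. Its values lie in [K], so they compare
    directly with moduli of complex numbers. *)
Definition entry_norm {K : numDomainType} {m n : nat} (A : 'M[K]_(m, n)) : K :=
  \sum_i \sum_j `|A i j|.

Lemma entry_norm_ge0 (K : numDomainType) (m n : nat) (A : 'M[K]_(m, n)) :
  0 <= entry_norm A.
Proof. by do 2!(apply: sumr_ge0 => ? _). Qed.

Lemma entry_norm_ge (K : numDomainType) (m n : nat) (A : 'M[K]_(m, n)) i j :
  `|A i j| <= entry_norm A.
Proof.
rewrite /entry_norm (bigD1 i)//= (bigD1 j)//= -addrA lerDl addr_ge0//.
  exact: sumr_ge0.
by do 2!(apply: sumr_ge0 => ? _).
Qed.

Lemma entry_normD (K : numDomainType) (m n : nat) (A B : 'M[K]_(m, n)) :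
  entry_norm (A + B) <= entry_norm A + entry_norm B.
Proof.
rewrite -big_split; apply: ler_sum => i _; rewrite -big_split.
by apply: ler_sum => j _; rewrite mxE ler_normD.
Qed.

Lemma entry_normZ (K : numDomainType) (m n : nat) (c : K) (A : 'M[K]_(m, n)) :
  entry_norm (c *: A) = `|c| * entry_norm A.
Proof.
rewrite mulr_sumr; apply: eq_bigr => i _; rewrite mulr_sumr.
by apply: eq_bigr => j _; rewrite mxE normrM.
Qed.

Lemma entry_normN (K : numDomainType) (m n : nat) (A : 'M[K]_(m, n)) :
  entry_norm (- A) = entry_norm A.
Proof. by rewrite -scaleN1r entry_normZ normrN normr1 mul1r. Qed.

Lemma entry_normB (K : numDomainType) (m n : nat) (A B : 'M[K]_(m, n)) :
  entry_norm (A - B) <= entry_norm A + entry_norm B.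
Proof. by rewrite -(entry_normN _ _ _ B) entry_normD. Qed.

Lemma entry_normM (K : numDomainType) (m n p : nat)
    (A : 'M[K]_(m, n)) (B : 'M[K]_(n, p)) :
  entry_norm (A *m B) <= entry_norm A * entry_norm B.
Proof.
rewrite {1}/entry_norm {1}/entry_norm mulr_suml; apply: ler_sum => i _.
apply: (@le_trans _ _ (\sum_k \sum_j `|A i j| * `|B j k|)).
  apply: ler_sum => k _; rewrite mxE; apply: le_trans (ler_norm_sum _ _ _) _.
  by apply: ler_sum => j _; rewrite normrM.
rewrite exchange_big mulr_suml; apply: ler_sum => j _.
rewrite -mulr_sumr ler_wpM2l// /entry_norm (bigD1 j)//= lerDl.
by do 2!(apply: sumr_ge0 => ? _).
Qed.

(** * First-order expansion of power series and of matrix quotients *)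

Lemma geometric_sum_le2 (K : numFieldType) (q : K) (N : nat) :
  0 <= q -> q <= 2^-1 -> \sum_(k < N) q ^+ k <= 2.
Proof.
move=> q0 q2; elim: N => [|N IH]; first by rewrite big_ord0.
rewrite big_ord_recl expr0.
under eq_bigr do rewrite /= /bump /= add1n exprS.
rewrite -mulr_sumr; apply: (@le_trans _ _ (1 + 2^-1 * 2)).
  by rewrite lerD2l ler_pM// sumr_ge0// => k _; rewrite exprn_ge0.
by rewrite mulVf ?pnatr_eq0.
Qed.

(** Convergence at the single point [d / 2] bounds the partial sums by some M, hence the terms there
    by 2 M. For |x| < d / 4 the terms are then dominated by a geometric series of ratio [q] at most
    1/2, and the tail from degree 2 is at most 4 M q^2. *)
Lemma pseries_linear_approx (K : numFieldType) (u : nat -> K) (f : K -> K) (d : K) :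
  0 < d ->
  (forall x, `|x| < d ->
     (fun N => \sum_(k < N) (x ^+ k * u k : K^o)) @ \oo --> (f x : K^o)) ->
  exists2 M, 0 <= M & forall x, `|x| < d / 4 ->
    `|f x - (u 0%N + x * u 1%N)| <= M * `|x| ^+ 2.
Proof.
move=> d0 hf; set x1 := d / 2.
have x1_gt0 : 0 < x1 by rewrite divr_gt0.
have x1d : `|x1| < d.
  by rewrite gtr0_norm// ltr_pdivrMr// ltr_pMr// ltr1n.
have := cvgP _ (hf x1 x1d) => /cvg_seq_bounded/pinfty_ex_gt0[M M0 /= hM].
have hu k : `|x1 ^+ k * u k| <= M *+ 2.
  have -> : x1 ^+ k * u k =
      \sum_(j < k.+1) (x1 ^+ j * u j) - \sum_(j < k) (x1 ^+ j * u j).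
    by rewrite big_ord_recr/= addrAC subrr add0r.
  by apply: le_trans (ler_normB _ _) _; rewrite mulr2n lerD// hM.
exists (M *+ 4 / x1 ^+ 2).
  by rewrite divr_ge0 ?mulrn_wge0 ?exprn_ge0 ?ltW.
move=> x xd; set q := `|x| / x1.
have q0 : 0 <= q by rewrite divr_ge0// ltW.
have q2 : q <= 2^-1.
  rewrite ler_pdivrMr//; apply: le_trans (ltW xd) _.
  by rewrite le_eqVlt /x1; apply/orP; left; apply/eqP; field.
have xE : `|x| = q * x1 by rewrite /q divfK// gt_eqF.
have hxu k : `|x ^+ k * u k| <= M *+ 2 * q ^+ k.
  rewrite normrM normrX xE exprMn -mulrA mulrC ler_wpM2r ?exprn_ge0//.
  by apply: le_trans _ (hu k); rewrite normrM normrX (gtr0_norm x1_gt0).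
have xdd : `|x| < d.
  by apply: lt_le_trans xd _; rewrite ler_pdivrMr// ler_peMr ?ler1n// ltW.
(* Only finite tails are estimated: a partial sum within [e] of [f x] is used, and its length [N.+2]
   leaves room to split off the first two terms. *)
apply/ler_addgt0Pr => e e0.
have [N _ HN] := (cvgrPdist_lt _ _).1 (hf x xdd) e e0.
have {HN} := HN N.+2 (leq_trans (leqnSn _) (leqnSn _)) => /= HN.
set S := \sum_(k < N.+2) _ in HN.
have SE : S = (u 0%N + x * u 1%N) + \sum_(k < N) x ^+ k.+2 * u k.+2.
  by rewrite /S 2!big_ord_recl/= expr0 mul1r addrA expr1.
have -> : f x - (u 0%N + x * u 1%N) = \sum_(k < N) x ^+ k.+2 * u k.+2 + (f x - S).
  by rewrite SE; ring.
apply: le_trans (ler_normD _ _) _; apply: lerD; last exact: ltW.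
apply: le_trans (ler_norm_sum _ _ _) _.
apply: (@le_trans _ _ (\sum_(k < N) M *+ 2 * q ^+ 2 * q ^+ k)).
  by apply: ler_sum => k _; rewrite -mulrA -exprD add2n.
rewrite -mulr_sumr; apply: (@le_trans _ _ (M *+ 2 * q ^+ 2 * 2)).
  by rewrite ler_wpM2l ?geometric_sum_le2// mulr_ge0 ?exprn_ge0// mulrn_wge0// ltW.
rewrite le_eqVlt; apply/orP; left; apply/eqP; rewrite /q; field.
by rewrite gt_eqF.
Qed.

Lemma mx_pseries_linear_approx (R : realType) (n : nat)
    (u : nat -> 'M[R[i]]_n) (F : R[i] -> 'M[R[i]]_n) (d : R[i]) :
  0 < d ->
  (forall x, `|x| < d -> mx_has_sum (fun k => x ^+ k *: u k) (F x)) ->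
  exists2 M, 0 <= M & forall x, `|x| < d / 4 ->
    entry_norm (F x - (u 0%N + x *: u 1%N)) <= M * `|x| ^+ 2.
Proof.
move=> d0 hF.
have /choice[M hM] : forall ij : 'I_n * 'I_n, exists M : R[i], 0 <= M /\
    forall x, `|x| < d / 4 ->
    `|F x ij.1 ij.2 - (u 0%N ij.1 ij.2 + x * u 1%N ij.1 ij.2)| <= M * `|x| ^+ 2.
  move=> [i j] /=.
  have [x xd|M M0 hM] := @pseries_linear_approx _ (fun k => u k i j)
      (fun x => F x i j) d d0; last by exists M.
  by have := hF x xd i j; under eq_fun do under eq_bigr do rewrite mxE.
exists (\sum_i \sum_j M (i, j)).
  by apply: sumr_ge0 => i _; apply: sumr_ge0 => j _; case: (hM (i, j)).
move=> x xd; rewrite mulr_suml; apply: ler_sum => i _.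
rewrite mulr_suml; apply: ler_sum => j _.
by case: (hM (i, j)) => _ /(_ x xd); rewrite !mxE.
Qed.

(** [M1] solves W0 M1 + W1 M0 = V1, the first-order part of W M = V. Only [W0] is inverted: the
    remainder G of [M] satisfies W0 G = O(x^2) - O(x) G, and the last term is absorbed for small
    x. *)
Lemma mx_quotient_linear_approx (K : numFieldType) (n : nat)
    (W0 W1 V0 V1 : 'M[K]_n) (W M : K -> 'M[K]_n) (d a b : K) :
  W0 \in unitmx -> 0 < d -> 0 <= a -> 0 <= b ->
  (forall x, `|x| < d -> entry_norm (W x - (W0 + x *: W1)) <= a * `|x| ^+ 2) ->
  (forall x, `|x| < d ->
     entry_norm (W x *m M x - (V0 + x *: V1)) <= b * `|x| ^+ 2) ->
  let M0 := invmx W0 *m V0 in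
  let M1 := invmx W0 *m (V1 - W1 *m M0) in
  exists2 e, 0 < e & exists2 k, 0 <= k & forall x, `|x| < e ->
    entry_norm (M x - (M0 + x *: M1)) <= k * `|x| ^+ 2.
Proof.
move=> W0u d0 a0 b0 hW hV M0 M1.
set N := entry_norm (invmx W0).
(* For |x| <= 1, c |x| bounds [N] times the norm of the factor x W1 + E1 that multiplies G in
   [GE]. *)
set c := N * (entry_norm W1 + a).
have N0 : 0 <= N by exact: entry_norm_ge0.
have c0 : 0 <= c by rewrite mulr_ge0// addr_ge0// entry_norm_ge0.
(* The four summands bound, up to |x|^2, the four terms of [GE] free of G. *)
set l := b + a * entry_norm M0 + entry_norm (W1 *m M1) + a * entry_norm M1.
have l0 : 0 <= l.
  by rewrite !addr_ge0// ?mulr_ge0// entry_norm_ge0.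
have c2 : 0 <= c *+ 2 by rewrite mulrn_wge0.
have dV : 0 < d^-1 by rewrite invr_gt0.
(* The radius [e^-1] meets three requirements at once: |x| <= 1, |x| < d and 2 c |x| <= 1. *)
pose e := 1 + d^-1 + c *+ 2.
have e1 : 1 <= e by rewrite /e -addrA lerDl addr_ge0// ltW.
have ed : d^-1 <= e by rewrite /e addrAC lerDr addr_ge0.
have ec : c *+ 2 <= e by rewrite /e lerDr addr_ge0// ltW.
have e0 : 0 < e by apply: lt_le_trans e1.
exists e^-1; first by rewrite invr_gt0.
exists (N * l *+ 2) => [|x]; first by rewrite mulrn_wge0// mulr_ge0.
rewrite -[ltRHS]mul1r ltr_pdivlMr// => xe.
have x1 : `|x| <= 1 by apply: le_trans _ (ltW xe); rewrite ler_peMr.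
have xd : `|x| < d.
  rewrite -[ltRHS]mul1r -ltr_pdivrMr//; apply: le_lt_trans _ xe.
  by rewrite ler_wpM2l.
have xc : `|x| * c *+ 2 <= 1.
  by apply: le_trans _ (ltW xe); rewrite -mulrnAr ler_wpM2l.
have {hW} := hW x xd; have {hV} := hV x xd.
set E2 := _ - (V0 + _) => hE2; set E1 := _ - (W0 + _) => hE1.
set G := M x - _.
have GE : W0 *m G =
    E2 - E1 *m M0 - x ^+ 2 *: (W1 *m M1) - x *: (E1 *m M1) - (x *: W1 + E1) *m G.
  have Wx : W x = W0 + x *: W1 + E1 by rewrite addrC subrK.
  have V0E : V0 = W0 *m M0 by rewrite mulKVmx.
  have V1E : V1 = W0 *m M1 + W1 *m M0 by rewrite mulKVmx// subrK.
  have E2E : E2 = (W0 + x *: W1 + E1) *m M x - (W0 *m M0 + x *: (W0 *m M1 + W1 *m M0)).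
    by rewrite -Wx -V0E -V1E.
  rewrite {}E2E /G !mulmxDl !mulmxBr !mulmxDr -!scalemxAr -!scalemxAl.
  by apply/matrixP => i j; rewrite ![_ i j]mxE; ring.
(* The last term is absorbed on the left, as its factor is at most 1/2. *)
have nG : entry_norm G <= N * (l * `|x| ^+ 2) + `|x| * c * entry_norm G.
  have -> : `|x| * c * entry_norm G =
      N * (`|x| * (entry_norm W1 + a) * entry_norm G) by rewrite /c; ring.
  rewrite -mulrDr -{1}(mulKmx W0u G) GE.
  apply: le_trans (entry_normM _ _ _ _ _ _) _; rewrite ler_wpM2l//.
  apply: le_trans (entry_normB _ _ _ _ _) _; apply: lerD.
    rewrite /l !mulrDl; apply: le_trans (entry_normB _ _ _ _ _) _; apply: lerD.
      apply: le_trans (entry_normB _ _ _ _ _) _; apply: lerD.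
        apply: le_trans (entry_normB _ _ _ _ _) _; apply: lerD; first exact: hE2.
        apply: le_trans (entry_normM _ _ _ _ _ _) _.
        by rewrite mulrAC ler_wpM2r// entry_norm_ge0.
      by rewrite entry_normZ normrX mulrC.
    rewrite entry_normZ; apply: le_trans (ler_piMl (entry_norm_ge0 _ _ _ _) x1) _.
    apply: le_trans (entry_normM _ _ _ _ _ _) _.
    by rewrite mulrAC ler_wpM2r// entry_norm_ge0.
  apply: le_trans (entry_normM _ _ _ _ _ _) _.
  rewrite ler_wpM2r ?entry_norm_ge0//.
  apply: le_trans (entry_normD _ _ _ _ _) _; rewrite mulrDr entry_normZ lerD2l.
  apply: le_trans hE1 _; by rewrite mulrC ler_wpM2r// expr2 ler_piMl//.
have : entry_norm G *+ 2 <= N * (l * `|x| ^+ 2) *+ 2 + entry_norm G.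
  apply: le_trans (ler_wMn2r 2 nG) _.
  by rewrite mulrnDl lerD2l -mulrnAl ler_piMl// entry_norm_ge0.
by rewrite [leLHS]mulr2n lerD2r -mulrnAl mulrA mulrnAl.
Qed.

(** * Invertibility of the monodromy and its first-order deformation *)

(** One point suffices, here x = r / 2: both [W s] and [W (loop s)] are invertible, and the second
    is the first times [M0]. *)
Lemma is_monodromy_unitmx (R : realType) (n : nat) (r : R)
    (W : R[i] -> 'M[R[i]]_n) (M0 : 'M[R[i]]_n) :
  0 < r -> (forall s, logdisc r s -> W s \in unitmx) ->
  is_monodromy r W (fun=> M0) -> M0 \in unitmx.
Proof.
move=> r0 Wu hM0.
have lr : logdisc r ((ln (r / 2))%:C : R[i]).
  apply/logdiscE => /=; rewrite lnK ?posrE ?divr_gt0//.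
  by rewrite ltr_pdivrMr// ltr_pMr// ltr1n.
have := Wu _ (logdisc_loop _ _ _ lr).
by rewrite (hM0 _ lr) unitmx_mul => /andP[].
Qed.

Lemma dyson_term0 (R : realType) (n : nat) (W B : R[i] -> 'M[R[i]]_n) (s : R[i]) :
  dyson_term W B 0 s = W s.
Proof. exact: mulmx1. Qed.

Lemma dyson_term1 (R : realType) (n : nat) (W B : R[i] -> 'M[R[i]]_n) (s : R[i]) :
  dyson_term W B 1 s = W s *m Cmx W B s.
Proof.
by rewrite /dyson_term /=; under eq_fun do rewrite mulmx1.
Qed.

Theorem theorem2p3 (R : realType) (n : nat)
  (sing : seq R[i]) (A : R[i] -> 'M[R[i]]_n)
  (hA : is_fuchsian sing A) (h0 : 0 \in sing)
  (r : R) (hr : 0 < r)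
  (hsing : forall a : R[i], a \in sing -> a != 0 -> r%:C <= `|a|)
  (W : R[i] -> 'M[R[i]]_n)
  (hW : is_fundamental r (fun s => A (cexp s)) W)
  (M0 : 'M[R[i]]_n) (hM0 : is_monodromy r W (fun=> M0))
  (B : R[i] -> 'M[R[i]]_n) (hB : mx_holomorphic r B)
  (hgen : forall s, logdisc r s -> mx_ray_integrable (conj_by W B) s) :
  (* rho a small complex number *)
  (forall (rho0 : R) (Wrho Mrho : R[i] -> R[i] -> 'M[R[i]]_n),
     0 < rho0 ->
     (forall rho : R[i], `|rho| < rho0%:C ->
        is_fundamental r (fun s => A (cexp s) + rho *: B s) (Wrho rho) /\
        (forall s, logdisc r s ->
           mx_has_sum (fun k => rho ^+ k *: dyson_term W B k s) (Wrho rho s)) /\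
        is_monodromy r (Wrho rho) (Mrho rho)) ->
     forall s, logdisc r s ->
       mx_O_rho2 (fun rho => Mrho rho s -
         (M0 + rho *: ((M0 *m Cmx W B (loop s) *m invmx M0 - Cmx W B s) *m M0))))
  /\
  (* rho a formal parameter *)
  (forall Wf Mf : nat -> R[i] -> 'M[R[i]]_n,
     (forall k s, logdisc r s -> Wf k s = dyson_term W B k s) ->
     (forall k s, logdisc r s ->
        mx_is_xderive (Wf k) s
          (A (cexp s) *m Wf k s + (if k is l.+1 then B s *m Wf l s else 0))) ->
     (forall k s, logdisc r s ->
        Wf k (loop s) = fps_mul (Wf^~ s) (Mf^~ s) k) ->
     forall s, logdisc r s ->
       Mf 0%N s = M0 /\
       Mf 1%N s = (M0 *m Cmx W B (loop s) *m invmx M0 - Cmx W B s) *m M0).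
Proof.
have Wu s : logdisc r s -> W s \in unitmx.
  exact: (@fundamental_unitmx _ _ _ _ _ _ _ hA hsing hW).
have M0u : M0 \in unitmx := @is_monodromy_unitmx _ _ _ _ _ hr Wu hM0.
have M1E s : (M0 *m Cmx W B (loop s) *m invmx M0 - Cmx W B s) *m M0 =
    M0 *m Cmx W B (loop s) - Cmx W B s *m M0.
  by rewrite mulmxBl mulmxKV.
split=> [rho0 Wrho Mrho rho0_gt0 hrho s sr | Wf Mf WfE _ hMf s sr]; last first.
  have sr' := logdisc_loop _ _ _ sr.
  have Mf0 : Mf 0%N s = M0.
    have := hMf 0%N s sr.
    rewrite /fps_mul big_ord_recl big_ord0 addr0 !WfE// !dyson_term0 hM0//.
    by move=> /(can_inj (mulKmx (Wu s sr))).
  (* The coefficient of rho reads W M0 C' = W Mf1 + W C M0, with C' the value of C after the loop;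
     cancelling W leaves [M1E]. *)
  split=> //; have := hMf 1%N s sr.
  rewrite /fps_mul !big_ord_recl big_ord0 addr0 /= !WfE// dyson_term0 !dyson_term1.
  rewrite subn0 subnn Mf0 hM0// M1E.
  move: (Cmx W B s) (Cmx W B (loop s)) => C C'; rewrite -!mulmxA -mulmxDr.
  by move=> /(can_inj (mulKmx (Wu s sr)))->; rewrite addrK.
have sr' := logdisc_loop _ _ _ sr.
have d0 : 0 < rho0%:C :> R[i] by rewrite ltcR.
have hsum u : logdisc r u -> forall x, `|x| < rho0%:C ->
    mx_has_sum (fun k => x ^+ k *: dyson_term W B k u) (Wrho x u).
  by move=> ur x /hrho[_ [hs _]]; exact: hs.
(* The Dyson series is expanded on both sheets, at [s] and at [loop s]; the monodromy relation makes
   the second expansion one of [Wrho x s *m Mrho x s]. *)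
have [a a0] := @mx_pseries_linear_approx _ _ _ (Wrho^~ s) _ d0 (hsum s sr).
have [b b0] :=
  @mx_pseries_linear_approx _ _ _ (Wrho^~ (loop s)) _ d0 (hsum _ sr').
rewrite !dyson_term0 !dyson_term1 (hM0 s sr) M1E.
move: (Cmx W B s) (Cmx W B (loop s)) => C C' hb ha.
have d40 : 0 < rho0%:C / 4 :> R[i] by rewrite divr_gt0.
have hq x : `|x| < rho0%:C / 4 -> entry_norm (Wrho x s *m Mrho x s -
    (W s *m M0 + x *: (W s *m M0 *m C'))) <= b * `|x| ^+ 2.
  move=> xd; have xr : `|x| < rho0%:C.
    by apply: lt_le_trans xd _; rewrite ler_pdivrMr// ler_peMr ?ler1n// ltW.
  by case: (hrho x xr) => _ [_ <-//]; exact: hb.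
have [e e0 [k k0]] := @mx_quotient_linear_approx _ _ _ _ _ _ _ (Mrho^~ s)
  _ _ _ (Wu s sr) d40 a0 b0 ha hq.
(* With W1 = W C, V0 = W M0 and V1 = W M0 C', the quotient coefficients reduce to [M0] and M0 C' - C
   M0. *)
rewrite mulKmx ?Wu// -!mulmxA -mulmxBr mulKmx ?Wu// => hk.
(* Nonnegative elements of [R[i]] are real, so taking real parts loses nothing. *)
exists (complex.Re k), (complex.Re e).
have eE : (complex.Re e)%:C = e by rewrite RRe_real// gtr0_real.
split=> [|x]; first by rewrite -ltcR eE.
rewrite eE => xe i j; rewrite RRe_real ?ger0_real//.
apply: le_trans (entry_norm_ge _ _ _ _ _ _) _; exact: hk.
Qed.
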